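(* The function $\phi(u,t)=\mathbf{P}(\tau_u\ge t)$ satisfies the Fredholm type equation $$\phi(u,t)=\phi_0(u,t)+\mathcal{K}\phi(u,t),\qquad (u,t)\in(0,\infty)^2,$$ where $\phi_0(u,t)=\mathbf{P}(W\ge t)\,I_{\{t\le u/c\}}$.
   Context: Let $c>0$ be a constant. Let $(W_i,X_i)$, $i=1,2,\dots$, be independent and identically distributed random vectors with the law of $(W,X)$, where $W\ge 0$ and $X>0$ ($W_i$ and $X_i$ may be dependent on each other). Put $T_0=0$, $T_n=W_1+\dots+W_n$. The cash flow process is $$U_t=c\sum_{n=0}^\infty 1_{[T_n,T_{n+1})}(t)\Big\{(t-T_n)e^{-\sum_{i=1}^nX_i}+\sum_{i=1}^n(T_i-T_{i-1})e^{-\sum_{k=1}^{i-1}X_k}\Big\},\quad t\ge 0,$$ with empty sums equal to $0$. For $u>0$ let $\tau_u$ be the first hitting time of level $u$ by $U$ (with $\tau_u=\infty$ if $u$ is never reached). The finite-time probability of default is $\phi(u,t)=\mathbf{P}(\tau_u\ge t)$. For a bounded measurable function $h$ on $(0,\infty)^2$, $$\mathcal{K}h(u,t)=\mathbf{E}\big[I_{\{W<t\wedge\frac uc\}}\,h(e^X(u-cW),\,t-W)\big].$$ *)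

(* Defs.v *)
From HB Require Import structures.
From mathcomp Require Import all_boot all_order all_algebra finmap.
From mathcomp Require Import all_classical all_reals all_analysis.

Set Implicit Arguments.
Unset Strict Implicit.
Unset Printing Implicit Defensive.

Import Order.TTheory GRing.Theory Num.Theory.
Import numFieldNormedType.Exports.

Local Open Scope classical_set_scope.
Local Open Scope ring_scope.

(* Random elements are plain functions here; they are measurable wherever
   the definitions are used. *)
Definition identically_distributed d d' (Omega : measurableType d)
    (S : measurableType d') (R : realType) (P : probability Omega R)
    (Y Z : Omega -> S) : Prop :=
  forall A : set S, measurable A -> P (Y @^-1` A) = P (Z @^-1` A).

Definition mutually_independent d d' (Omega : measurableType d)
    (S : measurableType d') (R : realType) (P : probability Omega R)
    (Y : nat -> Omega -> S) : Prop :=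
  forall (J : {fset nat}) (A : nat -> set S),
    (forall i, i \in J -> measurable (A i)) ->
    P (\bigcap_(i in [set` J]) (Y i @^-1` A i)) =
    (\prod_(i <- J) P (Y i @^-1` A i))%E.

Section cash_flow.
Variables (Omega : Type) (R : realType).

(* Sequences are indexed from 0: W i and X i are the usual W_{i+1}, X_{i+1}. *)
Implicit Types W X : nat -> Omega -> R.

Definition arrival W (n : nat) (w : Omega) : R := \sum_(0 <= i < n) W i w.

(* For W >= 0 the intervals `[T_n, T_{n+1}[ are pairwise disjoint, so that at
   most one term of the series is nonzero and the limit always exists. *)
Definition cash_flow (c : R) W X (t : R) (w : Omega) : R :=
  c * \big[+%R/0]_(0 <= n <oo)
    (\1_(`[arrival W n w, arrival W n.+1 w[) t *
     ((t - arrival W n w) * expR (- \sum_(0 <= i < n) X i w) +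
      \sum_(0 <= i < n) (arrival W i.+1 w - arrival W i w) *
                        expR (- \sum_(0 <= k < i) X k w))).

(* ereal_inf set0 = +oo : the time is infinite when u is never reached. *)
Definition hitting_time (c : R) W X (u : R) (w : Omega) : \bar R :=
  ereal_inf [set t%:E | t in [set t : R | 0 <= t /\ cash_flow c W X t w = u]].

End cash_flow.

Section default_probability.
Variables (d : measure_display) (Omega : measurableType d) (R : realType).
Variable P : probability Omega R.

Definition default_prob (c : R) (W X : nat -> Omega -> R) (u t : R) : R :=
  fine (P [set w | (t%:E <= hitting_time c W X u w)%E]).

Definition default_prob0 (c : R) (W : Omega -> R) (u t : R) : R :=
  fine (P [set w | (t <= W w)%R]) * (t <= u / c)%R%:R.

(* Functions on (0,oo)^2 are represented by total functions: the indicator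
   vanishes unless both arguments of h are positive.  The expectation has its
   usual meaning for h bounded and measurable on (0,oo)^2. *)
Definition fredholm_op (c : R) (W X : Omega -> R) (h : R -> R -> R)
    (u t : R) : R :=
  fine 'E_P[fun w => \1_[set w' | (W w' < Num.min t (u / c))%R] w *
                     h (expR (X w) * (u - c * W w)) (t - W w)].

End default_probability.

(* Main.v *)
Require Import Defs.
From HB Require Import structures.
From mathcomp Require Import all_boot all_order all_algebra finmap.
From mathcomp Require Import all_classical all_reals all_analysis.
From mathcomp Require Import measurable_realfun.

Set Implicit Arguments.
Unset Strict Implicit.
Unset Printing Implicit Defensive.

Import Order.TTheory GRing.Theory Num.Theory.
Import numFieldNormedType.Exports.

Local Open Scope classical_set_scope.
Local Open Scope ring_scope.

(** Why the theorem is true.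

Condition on the first pair (W_1, X_1).  If u < c W_1, the level u is reached
during the first inter-arrival time, at time u / c.  If u > c W_1, the flow
restarts at time W_1 with payments discounted by exp(- X_1), so the path
reaches u exactly when the shifted path reaches exp(X_1) (u - c W_1), and
W_1 units of time later.  The shifted sequence is independent of (W_1, X_1) and
distributed as the whole sequence, so the event W_1 < min(t, u / c)
contributes [fredholm_op].  If W_1 >= t, then u is not reached before t when
t <= u / c and is reached at u / c < t otherwise, which gives [default_prob0].
If u / c < W_1 < t, then u is reached at u / c, before t.

The proof separates the pathwise argument from the probabilistic one.

Pathwise ([le_hitting_time]), for u > 0 the hitting time is at least t if and
only if, for every n, a crossing of u during the n-th inter-arrival time takes
place no earlier than t ([no_hit_before]).  This condition is a countable
conjunction of inequalities between finite sums.  Hence it is measurable, and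
its behaviour when a pair is put in front of the sequence
([no_hit_before_cons]) is plain algebra.

Probabilistically ([iid_law_cons]), the law of an i.i.d. sequence on the path
space is invariant under prepending an independent copy of one term.  The two
laws agree on cylinders, and these form a pi-system generating the
sigma-algebra of paths.

One boundary case needs an argument.  If u = c W_1 < t, the original flow
reaches u at time W_1 = u / c, except when all later W_i vanish: the
half-open intervals are then empty and u is never attained.  This exception
is negligible by a zero-one argument ([iid_stay_01]): if the W_i all vanish
with positive probability, then W = 0 almost surely, and W = u / c has
probability zero. *)

(** * The path space and the law of an i.i.d. sequence *)

Section path_space.
Context d (S : measurableType d).

Definition cylinder (n : nat) (A : nat -> set S) : set (nat -> S) :=
  [set s | forall i, (i < n)%N -> A i (s i)].

Definition cylinders : set (set (nat -> S)) :=
  [set C | exists n A, (forall i, measurable (A i)) /\ C = cylinder n A].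

Definition path_space := g_sigma_algebraType cylinders.

(** The codomain is annotated as [path_space], rather than as a plain function
    type, so that it carries the cylinder sigma-algebra. *)
Definition path_cons (ys : S * path_space) : path_space :=
  fun i => if i is j.+1 then ys.2 j else ys.1.

(** Padding the shorter cylinder with full sides puts both on the same number of
    coordinates. *)
Lemma setI_closed_cylinders : setI_closed cylinders.
Proof.
move=> _ _ [n [A [mA ->]]] [m [B [mB ->]]].
exists (maxn n m), (fun i => (if (i < n)%N then A i else setT) `&`
                             (if (i < m)%N then B i else setT)); split.
  by move=> i; apply: measurableI; case: ifP.
apply/seteqP; split => [s [sA sB] i _|s sAB].
  by split; case: ifP => // ?; [exact: sA|exact: sB].
by split=> i im; have := sAB i; rewrite leq_max im ?orbT => /(_ isT)[].
Qed.

Lemma measurable_coord i : measurable_fun [set: path_space] (fun s => s i).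
Proof.
move=> _ B mB; rewrite setTI; apply: sub_sigma_algebra.
exists i.+1, (fun j => if j == i then B else setT); split.
  by move=> j; case: ifP.
apply/seteqP; split => [s /= sB j _|s /= /(_ i (ltnSn i))]; last by rewrite eqxx.
by case: eqP => // ->.
Qed.

Lemma measurable_cylinder n A : (forall i, measurable (A i)) ->
  @measurable _ path_space (cylinder n A).
Proof. by move=> mA; apply: sub_sigma_algebra; exists n, A. Qed.

Lemma measurable_to_path_space d' (T : measurableType d')
    (f : T -> path_space) :
  (forall i, measurable_fun setT (fun x => f x i)) -> measurable_fun setT f.
Proof.
move=> mf; apply: (@measurability _ _ T path_space setT f cylinders) => //.
move=> _ [_ [n [A [mA ->]]] <-]; rewrite setTI.
rewrite (_ : f @^-1` _ = \bigcap_(i in `I_n) ((fun x => f x i) @^-1` A i)) //.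
apply: fin_bigcap_measurable => [|i _]; first exact: finite_II.
rewrite -[X in measurable X]setTI.
exact: mf.
Qed.

Lemma measurable_path_cons : measurable_fun setT path_cons.
Proof.
apply: measurable_to_path_space => -[|i] //=.
  exact: (@measurable_fst _ _ S path_space).
apply: (measurableT_comp (measurable_coord i)).
exact: (@measurable_snd _ _ S path_space).
Qed.

End path_space.

Section iid_law.
Context d d' (Omega : measurableType d) (S : measurableType d').
Context (R : realType) (P : probability Omega R).
Variables (Z : Omega -> S) (Y : nat -> Omega -> S).
Hypotheses (mZ : measurable_fun setT Z) (mY : forall i, measurable_fun setT (Y i)).
Hypothesis ident : forall i, identically_distributed P (Y i) Z.
Hypothesis indep : mutually_independent P Y.

Definition sample_path (w : Omega) : path_space S := fun i => Y i w.

Lemma measurable_sample_path : measurable_fun setT sample_path.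
Proof. by apply: measurable_to_path_space => i; exact: mY. Qed.

Lemma iid_cylinderE n (A : nat -> set S) : (forall i, measurable (A i)) ->
  P (sample_path @^-1` cylinder n A) = (\prod_(i < n) P (Z @^-1` A i))%E.
Proof.
move=> mA.
pose J : {fset nat} := [fset i in iota 0 n]%fset.
have JE i : (i \in J) = (i < n)%N by rewrite in_fset /= mem_iota add0n.
rewrite (_ : _ @^-1` _ = \bigcap_(i in [set` J]) (Y i @^-1` A i)); last first.
  apply/seteqP; split => [w /= wA i /=|w /= wA i i_n]; first by rewrite JE => /wA.
  by apply: wA; rewrite /= JE.
rewrite indep //.
rewrite (eq_bigr (fun i => P (Z @^-1` A i))); last by move=> i _; exact: ident.
rewrite (perm_big (iota 0 n)); last first.
  apply: uniq_perm; rewrite ?iota_uniq ?fset_uniq //.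
  by move=> i; rewrite JE mem_iota add0n.
by rewrite -{1}(subn0 n) -/(index_iota 0 n) big_mkord.
Qed.

(** Both the law of the sequence and the image under [path_cons] of the product
    (law of Z) x (law of the sequence) give mass prod_(i < n) P (Z in A_i) to
    the cylinder with sides A_0, ..., A_(n-1).  Hence they coincide, and the
    definition of the product measure as an integral of sections gives the
    formula. *)
Lemma iid_law_cons (D : set (path_space S)) : measurable D ->
  measurable_fun [set: Omega]
    (fun w => P [set w' | D (path_cons (Z w, sample_path w'))]) /\
  P (sample_path @^-1` D) =
  (\int[P]_w P [set w' | D (path_cons (Z w, sample_path w'))])%E.
Proof.
move=> mD.
pose ZZ : {mfun Omega >-> S} := HB.pack Z (isMeasurableFun.Build _ _ _ _ Z mZ).
pose YY : {mfun Omega >-> path_space S} :=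
  HB.pack sample_path (isMeasurableFun.Build _ _ _ _ sample_path measurable_sample_path).
pose nu := distribution P ZZ.
pose Q := distribution P YY.
pose CC : {mfun (S * path_space S)%type >-> path_space S} :=
  HB.pack (@path_cons _ S) (isMeasurableFun.Build _ _ _ _ _ (@measurable_path_cons _ S)).
pose m := pushforward (product_measure1 nu Q) CC.
have mE : measurable (@path_cons _ S @^-1` D).
  by rewrite -[X in measurable X]setTI; exact: measurable_path_cons.
have mQ := measurable_fun_xsection Q mE.
have secE y : Q (xsection (@path_cons _ S @^-1` D) y) =
    P [set w' | D (path_cons (y, sample_path w'))].
  rewrite /Q /= /distribution /pushforward; congr (P _).
  by apply/seteqP; split => w' /=; rewrite /xsection /= inE.
split.
  rewrite (_ : (fun w => _) = (fun y => Q (xsection (@path_cons _ S @^-1` D) y)) \o Z).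
    exact: measurableT_comp.
  by apply/funext => w /=; rewrite secE.
transitivity (Q D); first by [].
transitivity (m D); last first.
  rewrite /m /pushforward /product_measure1.
  rewrite ge0_integral_distribution //.
    by apply: eq_integral => w _ /=; rewrite secE.
apply: (@measure_unique _ _ (path_space S) (@cylinders _ S) (fun=> setT) _ _ _ _
  Q (pushforward (product_measure1 nu Q) CC)) => //.
- exact: setI_closed_cylinders.
- by move=> _; exists 0%N, (fun=> setT); split => //; apply/seteqP.
- by rewrite bigcup_const.
- move=> _ [n [A [mA ->]]].
  rewrite [LHS](iid_cylinderE _ mA).
  rewrite -[RHS]/((nu \x Q)%E (@path_cons _ S @^-1` cylinder n A)).
  case: n => [|n].
    rewrite big_ord0 (_ : _ @^-1` _ = setT `*` setT).
      rewrite product_measure1E//.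
      by rewrite [X in (X * _)%E]probability_setT [X in (_ * X)%E]probability_setT mule1.
    by rewrite setXTT; apply/seteqP.
  rewrite (_ : _ @^-1` _ = A 0%N `*` cylinder n (fun i => A i.+1)).
    rewrite product_measure1E//; last exact: measurable_cylinder.
    rewrite big_ord_recl; congr (_ * _)%E.
    by apply: esym; apply: iid_cylinderE => i; exact: mA.
  apply/seteqP; split => [[y s] /= sA|[y s] /= [yA sA] [|i]//]; last exact: sA.
  by split; [exact: (sA 0%N)|move=> i; exact: (sA i.+1)].
- by move=> _; rewrite [X in (X < _)%E]probability_setT ltry.
Qed.
End iid_law.

(** * A single path *)

Section deterministic_paths.
Variable R : realType.
Implicit Types (s : nat -> R * R) (c u t : R).

(** In the notation of the cash flow, [clock s n] is T_n, [log_discount s n] is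
    X_1 + ... + X_n, and [level c s n] is c times the second sum in the
    n-th term of the series: the amount accumulated over the first n periods. *)
Definition clock s n : R := \sum_(0 <= i < n) (s i).1.

Definition log_discount s n : R := \sum_(0 <= i < n) (s i).2.

Definition level c s n : R :=
  \sum_(0 <= i < n) c * (s i).1 * expR (- log_discount s i).

(** The time at which the n-th linear piece, continued to a whole line of slope
    c exp(- log_discount s n), takes the value u. *)
Definition crossing_time c u s n : R :=
  clock s n + (u - level c s n) * expR (log_discount s n) / c.

(** When all inter-arrival times are nonnegative, the n-th piece takes the value
    u if and only if level c s n <= u < level c s n.+1.  Quantifying over pieces rather than over
    times makes this event a countable intersection. *)
Definition no_hit_before c u t s : Prop :=
  forall n, level c s n <= u < level c s n.+1 -> t <= crossing_time c u s n.

Lemma clock0 s : clock s 0 = 0. Proof. exact: big_geq. Qed.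
Lemma log_discount0 s : log_discount s 0 = 0. Proof. exact: big_geq. Qed.
Lemma level0 c s : level c s 0 = 0. Proof. exact: big_geq. Qed.

Lemma clockS s n : clock s n.+1 = clock s n + (s n).1.
Proof. exact: big_nat_recr. Qed.

Lemma levelS c s n :
  level c s n.+1 = level c s n + c * (s n).1 * expR (- log_discount s n).
Proof. exact: big_nat_recr. Qed.

Lemma clock_cons y s n : clock (path_cons (y, s)) n.+1 = y.1 + clock s n.
Proof. by rewrite /clock big_nat_recl. Qed.

Lemma log_discount_cons y s n :
  log_discount (path_cons (y, s)) n.+1 = y.2 + log_discount s n.
Proof. by rewrite /log_discount big_nat_recl. Qed.

Lemma level_cons c y s n :
  level c (path_cons (y, s)) n.+1 = c * y.1 + expR (- y.2) * level c s n.
Proof.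
rewrite /level big_nat_recl//= log_discount0 oppr0 expR0 mulr1; congr (_ + _).
rewrite mulr_sumr; apply: eq_bigr => i _.
by rewrite log_discount_cons opprD expRD mulrCA.
Qed.

(** Prepending (a, b) turns level n into c a + exp(- b) level n and shifts the
    clock by a, so piece n.+1 of the longer path crosses u when piece n of s
    crosses exp(b) (u - c a).  The remaining piece 0 crosses u at time u / c. *)
Lemma no_hit_before_cons c u t y s : c != 0 ->
  no_hit_before c u t (path_cons (y, s)) <->
  (0 <= u < c * y.1 -> t <= u / c) /\
  no_hit_before c (expR y.2 * (u - c * y.1)) (t - y.1) s.
Proof.
move=> c0.
have lev n (v := expR y.2 * (u - c * y.1)) :
    (level c (path_cons (y, s)) n.+1 <= u) = (level c s n <= v).
  by rewrite level_cons -lerBrDl expRN mulrC ler_pdivrMr ?expR_gt0// mulrC.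
have step n : (t <= crossing_time c u (path_cons (y, s)) n.+1) =
    (t - y.1 <= crossing_time c (expR y.2 * (u - c * y.1)) s n).
  rewrite /crossing_time clock_cons log_discount_cons level_cons.
  rewrite [RHS]lerBlDl addrA; congr (_ <= _ + _ / _).
  rewrite opprD addrA mulrBl [in RHS]mulrBl expRD; congr (_ - _).
    by rewrite mulrA; congr (_ * _); rewrite mulrC.
  by rewrite mulrACA -expRD addNr expR0 mul1r.
have first_crossing : crossing_time c u (path_cons (y, s)) 0 = u / c.
  by rewrite /crossing_time clock0 log_discount0 level0 expR0 subr0 mulr1 add0r.
split=> [H|[H0 H] [|n]].
- split=> [u0|n un].
    rewrite -first_crossing; apply: H.
    by rewrite level_cons !level0 mulr0 addr0.
  by rewrite -step; apply: H; rewrite lev ltNge lev -ltNge.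
- by rewrite first_crossing level_cons !level0 mulr0 addr0; exact: H0.
- by rewrite step lev ltNge lev -ltNge; exact: H.
Qed.

End deterministic_paths.

Section hitting.
Variable R : realType.

(** The partial sums are eventually constant. *)
Lemma lim_series_single (f : nat -> R) n0 : (forall n, n != n0 -> f n = 0) ->
  \big[+%R/0]_(0 <= n <oo) f n = f n0.
Proof.
move=> f0; apply: lim_near_cst => //; near=> k.
have kn0 : (n0 < k)%N by near: k; exact: nbhs_infty_gt.
rewrite big_mkord (bigD1 (Ordinal kn0))//= big1 ?addr0// => i.
by rewrite -val_eqE /= => /f0.
Unshelve. all: by end_near. Qed.

Lemma clock_le (s : nat -> R * R) m n : (forall i, 0 <= (s i).1) ->
  (m <= n)%N -> clock s m <= clock s n.
Proof.
move=> s0 /subnK <-; elim: (_ - _)%N => // k IH.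
by rewrite addSn clockS (le_trans IH)// lerDl.
Qed.

Variables (Omega : Type) (W X : nat -> Omega -> R) (w : Omega) (c : R).
Hypothesis c_gt0 : 0 < c.
Hypothesis W_ge0 : forall i, 0 <= W i w.

Let s : nat -> R * R := fun i => (W i w, X i w).

Let f t n := \1_(`[arrival W n w, arrival W n.+1 w[) t *
     ((t - arrival W n w) * expR (- \sum_(0 <= i < n) X i w) +
      \sum_(0 <= i < n) (arrival W i.+1 w - arrival W i w) *
                        expR (- \sum_(0 <= k < i) X k w)).

Lemma cash_flow_on t n : clock s n <= t < clock s n.+1 ->
  cash_flow c W X t w =
  level c s n + c * (t - clock s n) * expR (- log_discount s n).
Proof.
move=> tn; rewrite /cash_flow (lim_series_single (f := f t) (n0 := n)).
  rewrite /f indicE mem_set ?mul1r; last by rewrite /= in_itv.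
  rewrite mulrDr mulrA addrC; congr (_ + _).
  rewrite mulr_sumr; apply: eq_bigr => i _.
  by rewrite /arrival big_nat_recr//= addrAC subrr add0r mulrA.
move=> m mn; rewrite /f indicE memNset ?mul0r //= in_itv /= => tm.
case/andP: tn => tn1 tn2; case/andP: tm => tm1 tm2.
have s0 i : 0 <= (s i).1 by exact: W_ge0.
case: (ltngtP m n) mn => // mn _.
  by have := clock_le s0 mn; rewrite leNgt (le_lt_trans tn1 tm2).
by have := clock_le s0 mn; rewrite leNgt (le_lt_trans tm1 tn2).
Qed.

(** Such times occur only if the arrivals accumulate; U then drops to 0, and so
    it misses every positive level. *)
Lemma cash_flow_off t : (forall n, ~ clock s n <= t < clock s n.+1) ->
  cash_flow c W X t w = 0.
Proof.
move=> tn; rewrite /cash_flow.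
have f0 n : f t n = 0.
  by rewrite /f indicE memNset ?mul0r //= in_itv /=; exact: tn.
by rewrite (lim_series_single (f := f t) (n0 := 0%N)) ?f0 ?mulr0.
Qed.

(** A positive value can be taken only on some piece, where U is affine with
    positive slope. *)
Lemma hitsP u x : 0 < u ->
  (0 <= x /\ cash_flow c W X x w = u) <->
  exists2 n, level c s n <= u < level c s n.+1 & x = crossing_time c u s n.
Proof.
move=> u0; have s0 i : 0 <= (s i).1 by exact: W_ge0.
have e0 n : 0 < c * expR (- log_discount s n) by rewrite mulr_gt0// expR_gt0.
have xE n v : c * (crossing_time c v s n - clock s n) *
    expR (- log_discount s n) = v - level c s n.
  rewrite /crossing_time [_ + _ - _]addrAC subrr add0r.
  by rewrite [c * _]mulrC divfK ?gt_eqF// expRN mulfK ?gt_eqF ?expR_gt0.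
have xE' n v : (v - level c s n) =
    (crossing_time c v s n - clock s n) * (c * expR (- log_discount s n)).
  by rewrite -xE mulrAC mulrC.
split.
  move=> [x0 xu].
  have [[n tn]|no] := pselect (exists n, clock s n <= x < clock s n.+1); last first.
    by move: u0; rewrite -xu cash_flow_off ?ltxx// => n tn; apply: no; exists n.
  exists n.
    rewrite -xu (cash_flow_on tn) levelS lerDl.
    case/andP: tn => tn1 tn2.
    rewrite pmulr_lge0 ?expR_gt0// pmulr_rge0 ?subr_ge0// tn1/=.
    by rewrite ltrD2l ltr_pM2r ?expR_gt0// ltr_pM2l// ltrBlDl -clockS.
  have -> : x = clock s n + c * (x - clock s n) / c.
    by rewrite mulrAC divff ?gt_eqF// mul1r addrC subrK.
  have ul : u - level c s n = c * (x - clock s n) / expR (log_discount s n).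
    by rewrite -xu (cash_flow_on tn) addrC addKr expRN.
  by rewrite /crossing_time ul divfK ?gt_eqF ?expR_gt0.
move=> [n /andP[nu un] ->].
have tn : clock s n <= crossing_time c u s n < clock s n.+1.
  rewrite -subr_ge0 -(pmulr_lge0 _ (e0 n)) -xE' subr_ge0 nu/=.
  rewrite clockS -ltrBlDl -(ltr_pM2r (e0 n)) -xE' ltrBlDl.
  by rewrite mulrCA mulrA -levelS.
split; last by rewrite (cash_flow_on tn) xE addrC subrK.
by case/andP: tn => + _; apply: le_trans; rewrite -(clock0 s) clock_le.
Qed.

Lemma le_hitting_time u t : 0 < u ->
  (t%:E <= hitting_time c W X u w)%E <-> no_hit_before c u t s.
Proof.
move=> u0; split => [tu n nu|H].
  rewrite -lee_fin (le_trans tu)//; apply: ereal_inf_lbound.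
  by exists (crossing_time c u s n) => //; apply/hitsP => //; exists n.
apply: le_ereal_inf_tmp => _ [x /(hitsP _ u0)[n nu ->] <-].
by rewrite lee_fin; exact: H.
Qed.

End hitting.

Section path_properties.
Variable R : realType.
Implicit Types (c u t : R) (s : nat -> R * R).

Lemma clock_ge0 s n : (forall i, 0 <= (s i).1) -> 0 <= clock s n.
Proof. by move=> s0; apply: sumr_ge0. Qed.

Lemma no_hit_before_le0 c u t s : 0 < c -> (forall i, 0 <= (s i).1) ->
  t <= 0 -> no_hit_before c u t s.
Proof.
move=> c0 s0 t0 n /andP[un _]; apply: (le_trans t0).
rewrite addr_ge0 ?clock_ge0// divr_ge0 ?(ltW c0)// mulr_ge0 ?expR_ge0//.
by rewrite subr_ge0.
Qed.

(** As long as all increments vanish, the level 0 is not crossed; the first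
    positive one would cross it at time 0, before t. *)
Lemma no_hit_before0 c t s : 0 < c -> (forall i, 0 <= (s i).1) -> 0 < t ->
  no_hit_before c 0 t s -> forall i, (s i).1 = 0.
Proof.
move=> c0 s0 t0 H; elim/ltn_ind => i IH.
have L0 : level c s i = 0.
  rewrite /level big_nat big1// => j /andP[_ ji].
  by rewrite IH// mulr0 mul0r.
have T0 : clock s i = 0 by rewrite /clock big_nat big1// => j /andP[_ /IH].
apply/eqP; rewrite eq_le s0 andbT leNgt; apply/negP => si.
have := H i; rewrite levelS L0 lexx add0r !mulr_gt0 ?expR_gt0// => /(_ isT).
by rewrite /crossing_time L0 T0 subr0 !mul0r addr0 leNgt t0.
Qed.

(** * Measurability of the avoidance event *)

Lemma measurable_set_ler d (T : measurableType d) (f g : T -> R) :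
  measurable_fun setT f -> measurable_fun setT g ->
  measurable [set x | f x <= g x].
Proof.
move=> mf mg; have := measurable_fun_ler mf mg.
by move=> /(_ measurableT [set true]); rewrite setTI; exact.
Qed.

Let PS := path_space (R * R)%type.

Lemma measurable_fst_coord i : measurable_fun [set: PS] (fun s => (s i).1).
Proof. exact: (measurableT_comp (@measurable_fst _ _ R R) (measurable_coord i)). Qed.

Lemma measurable_clock n : measurable_fun [set: PS] (fun s => clock s n).
Proof. by apply: measurable_sum => i; exact: measurable_fst_coord. Qed.

Lemma measurable_log_discount n :
  measurable_fun [set: PS] (fun s => log_discount s n).
Proof.
apply: measurable_sum => i.
exact: (measurableT_comp (@measurable_snd _ _ R R) (measurable_coord i)).
Qed.

Lemma measurable_level c n : measurable_fun [set: PS] (fun s => level c s n).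
Proof.
apply: measurable_sum => i; apply: measurable_funM.
  by apply: measurable_funM => //; exact: measurable_fst_coord.
apply: measurableT_comp => //; apply: measurableT_comp => //.
exact: measurable_log_discount.
Qed.

Lemma measurable_crossing_time c u n :
  measurable_fun [set: PS] (fun s => crossing_time c u s n).
Proof.
apply: measurable_funD; first exact: measurable_clock.
apply: measurable_funM => //; apply: measurable_funM.
  by apply: measurable_funB => //; exact: measurable_level.
by apply: measurableT_comp => //; exact: measurable_log_discount.
Qed.

Lemma measurable_no_hit_before c u t :
  measurable ([set s | no_hit_before c u t s] : set PS).
Proof.
rewrite (_ : [set s | _] = \bigcap_n
  (~` ([set s : PS | level c s n <= u] `&` ~` [set s : PS | level c s n.+1 <= u])
   `|` [set s : PS | t <= crossing_time c u s n])); last first.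
  apply/seteqP; split => [s H n _|s H n /andP[nu un]].
    have [/(H n)|nu] := boolP (level c s n <= u < level c s n.+1); first by right.
    left=> -[/= nu1 /negP]; rewrite -ltNge => nu2; move: nu; by rewrite nu1 nu2.
  have [/= []|//] := H n I; split => //; by apply/negP; rewrite -ltNge.
apply: bigcapT_measurable => n; apply: measurableU; last first.
  by apply: measurable_set_ler => //; exact: measurable_crossing_time.
apply: measurableC; apply: measurableI; last apply: measurableC.
  all: by apply: measurable_set_ler => //; exact: measurable_level.
Qed.

End path_properties.

(** * The equation *)

Section iid_stay.
Context d d' (Omega : measurableType d) (S : measurableType d').
Context (R : realType) (P : probability Omega R).
Variables (Z : Omega -> S) (Y : nat -> Omega -> S).
Hypotheses (mZ : measurable_fun setT Z) (mY : forall i, measurable_fun setT (Y i)).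
Hypothesis ident : forall i, identically_distributed P (Y i) Z.
Hypothesis indep : mutually_independent P Y.

(** Let q be the probability that the whole sequence stays in A.  Splitting off
    the first term gives q = P (Z in A) q, so q = 0 or P (Z in A) = 1. *)
Lemma iid_stay_01 (A : set S) : measurable A ->
  P (Z @^-1` A) = 1%E \/ P [set w | forall i, A (Y i w)] = 0%E.
Proof.
move=> mA; pose D : set (path_space S) := [set s | forall i, A (s i)].
have mD : measurable D.
  rewrite (_ : D = \bigcap_i ((fun s => s i) @^-1` A)).
    apply: bigcapT_measurable => i; rewrite -[X in measurable X]setTI.
    exact: measurable_coord.
  by apply/seteqP; split => [s sA i _|s sA i]; exact: sA.
pose q := P [set w | forall i, A (Y i w)].
have mZA : measurable (Z @^-1` A) by rewrite -[X in measurable X]setTI; exact: mZ.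
have mq : measurable [set w | forall i, A (Y i w)].
  by have := measurable_sample_path mY measurableT mD; rewrite setTI.
have qE : q = (P (Z @^-1` A) * q)%E.
  have [_ qint] := iid_law_cons mZ mY ident indep mD.
  transitivity (\int[P]_w P [set w' | D (path_cons (Z w, sample_path Y w'))])%E.
    exact: qint.
  transitivity (\int[P]_w ((\1_(Z @^-1` A) w)%:E * q))%E.
    apply: eq_integral => w _; rewrite indicE.
    case: (boolP (w \in _)) => [/set_mem /= ZA|/negP ZA]; rewrite ?mul1e ?mul0e.
      by congr (P _); apply/seteqP; split => [w' /= H i|w' /= H [|i]//=];
        [exact: (H i.+1)|exact: H].
    rewrite -[RHS](measure0 P); congr (P _); apply/seteqP; split => // w' /= H.
    by apply: ZA; apply/mem_set; have /= := H 0%N.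
  rewrite ge0_integralZr//; first by rewrite integral_indic// setIT.
    exact/measurable_EFinP/measurable_indic.
  exact: measure_ge0.
have [q0|q0] := eqVneq q 0%E; first by right.
left.
have qf : q \is a fin_num by exact: fin_num_measure.
have pf : P (Z @^-1` A) \is a fin_num by exact: fin_num_measure.
move: qE q0; rewrite -(fineK qf) -(fineK pf) -EFinM => -[qE] q0.
congr EFin; apply: (mulIf (x := fine q)); last by rewrite mul1r -qE.
by apply: contra_neq q0 => ->.
Qed.

End iid_stay.

Section first_payment.
Variables (d : measure_display) (Omega : measurableType d)
    (R : realType) (P : probability Omega R) (c : R)
    (W X : {RV P >-> R}) (Ws Xs : nat -> {RV P >-> R}).
Hypotheses
    (c_gt0 : 0 < c)
    (W_ge0 : forall w, 0 <= W w)
    (Ws_ge0 : forall i w, 0 <= Ws i w)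
    (ident : forall i, identically_distributed P
               (fun w => (Ws i w, Xs i w)) (fun w => (W w, X w)))
    (indep : mutually_independent P (fun i w => (Ws i w, Xs i w))).

Let Z w := (W w, X w).
Let Y i w := (Ws i w, Xs i w).
Let path := sample_path Y.

Let mZ : measurable_fun setT Z.
Proof. exact: measurable_fun_pair. Qed.

Let mY i : measurable_fun setT (Y i).
Proof. exact: measurable_fun_pair. Qed.

Let D u t : set (path_space (R * R)%type) := [set s | no_hit_before c u t s].

Let measurable_D u t : measurable (path @^-1` D u t).
Proof.
rewrite -[X in measurable X]setTI.
exact: (measurable_sample_path mY measurableT (measurable_no_hit_before c u t)).
Qed.

Lemma default_probE u t : 0 < u ->
  (default_prob P c Ws Xs u t)%:E = P (path @^-1` D u t).
Proof.
move=> u0; rewrite /default_prob.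
have -> : [set w | (t%:E <= hitting_time c Ws Xs u w)%E] = path @^-1` D u t.
  by apply/seteqP; split => w /=; rewrite (le_hitting_time _ c_gt0)//.
by rewrite fineK// fin_num_measure.
Qed.

(** This disposes of the paths with c W_1 = u on which all later inter-arrival
    times vanish. *)
Lemma no_positive_atom_or_no_standstill a : 0 < a ->
  P [set w | W w = a] = 0%E \/ P [set w | forall i, Ws i w = 0] = 0%E.
Proof.
move=> a0; pose A := [set y : R * R | y.1 = 0].
have mA : measurable A.
  have := @measurable_fst _ _ R R measurableT _ (measurable_set1 0).
  by rewrite setTI.
have [ZA|] := iid_stay_01 mZ mY ident indep mA; last by right.
left; apply/eqP; rewrite eq_le measure_ge0 andbT.
have mZA : measurable (Z @^-1` A) by rewrite -[X in measurable X]setTI; exact: mZ.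
have <- : P (~` (Z @^-1` A)) = 0%E by rewrite probability_setC// ZA subee.
apply: le_measure; rewrite ?inE.
- exact: (measurable_funPTI W (measurable_set1 a)).
- exact: measurableC.
- by move=> w /= Wa; rewrite /A/= Wa => aE; move: a0; rewrite aE ltxx.
Qed.

(** The recursion conditionally on (W_1, X_1) = (W w, X w).  In the
    boundary case W w = u / c < t both terms on the right vanish, while the left-hand
    side is P (W_i = 0 for all i); hence the disjunction in the hypothesis. *)
Lemma first_payment_split u t : 0 < u -> 0 < t -> forall w,
  W w <> u / c \/ P [set w' | forall i, Ws i w' = 0] = 0%E ->
  P [set w' | D u t (path_cons (Z w, path w'))] =
  ((\1_[set w' | t <= W w'] w * (t <= u / c)%R%:R)%:E +
   (\1_[set w' | (W w' < Num.min t (u / c))%R] w *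
     default_prob P c Ws Xs (expR (X w) * (u - c * W w)) (t - W w))%:E)%E.
Proof.
move=> u0 t0 w Hw.
have path_ge0 w' i : 0 <= (path w' i).1 by exact: Ws_ge0.
pose u' := expR (X w) * (u - c * W w).
have DE w' : D u t (path_cons (Z w, path w')) <->
    (0 <= u < c * W w -> t <= u / c) /\ D u' (t - W w) (path w').
  exact/no_hit_before_cons/lt0r_neq0.
have ltWE : (W w < u / c) = (c * W w < u) by rewrite ltr_pdivlMr// mulrC.
have gtWE : (u / c < W w) = (u < c * W w) by rewrite ltr_pdivrMr// mulrC.
(* the first piece already crosses u at time u / c, before t *)
have none : u / c < W w -> u / c < t ->
    [set w' | D u t (path_cons (Z w, path w'))] = set0.
  rewrite gtWE => uW ut; apply/seteqP; split => // w' /DE[+ _].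
  by rewrite (ltW u0) uW => /(_ isT); rewrite leNgt ut.
rewrite !indicE.
have [Wlt|Wge] := ltP (W w) (Num.min t (u / c)).
  rewrite [in X in (_ + X)%E]mem_set// mul1r.
  move: Wlt; rewrite lt_min => /andP[Wt]; rewrite ltWE => Wu.
  rewrite memNset; last by apply/negP; rewrite -ltNge.
  rewrite mul0r add0e default_probE; last by rewrite mulr_gt0 ?expR_gt0 ?subr_gt0.
  congr (P _); apply/seteqP; split => [w' /DE[]//|w' /= H]; apply/DE; split => //.
  by move=> /andP[_ /(lt_trans Wu)]; rewrite ltxx.
rewrite [in X in (_ + X)%E]memNset; last by apply/negP; rewrite -leNgt.
rewrite mul0r adde0.
have [tW|Wt] := leP t (W w).
  rewrite mem_set// mul1r; have [tu|ut] := leP t (u / c); last first.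
    by rewrite none ?measure0// (lt_le_trans ut).
  rewrite -[RHS](probability_setT P); congr (P _); apply/seteqP; split => // w' _.
  by apply/DE; split => //; apply: no_hit_before_le0; rewrite ?subr_le0.
rewrite memNset; last by apply/negP; rewrite -ltNge.
rewrite mul0r.
move: Wge; rewrite ge_min leNgt Wt/= => uW.
have ut := le_lt_trans uW Wt.
move: uW; rewrite le_eqVlt => /orP[/eqP uW|uW]; last by rewrite none ?measure0.
(* only W w = u / c < t is left, hence u' = 0 and q0 applies *)
case: Hw => [/(_ (esym uW))//|q0].
apply/eqP; rewrite eq_le measure_ge0 andbT -[X in (_ <= X)%E]q0.
have u'0 : u' = 0 by rewrite /u' -uW mulrCA divff ?gt_eqF// mulr1 subrr mulr0.
have mfrozen : measurable [set w' | forall i, Ws i w' = 0].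
  rewrite (_ : [set _ | _] = \bigcap_i (Ws i @^-1` [set 0])).
    by apply: bigcapT_measurable => i; exact: measurable_funPTI.
  by apply/seteqP; split => [w' H i _|w' H i]; exact: H.
have -> : [set w' | D u t (path_cons (Z w, path w'))] =
    path @^-1` D 0 (t - W w).
  apply/seteqP; split => w'; rewrite /= -u'0; first by move=> /DE[].
  move=> H; apply/DE; split => //; rewrite -gtWE uW ltxx andbF.
  by [].
apply: le_measure; rewrite ?inE // => w' /= H.
by apply: (no_hit_before0 c_gt0 (path_ge0 w') _ H); rewrite subr_gt0.
Qed.

Let below u t : set Omega := [set w | (W w < Num.min t (u / c))%R].

Lemma measurable_below u t : measurable (below u t).
Proof.
have := measurable_fun_ltr (@measurable_funPT _ _ _ _ W)
  (@measurable_cst _ _ Omega _ setT (Num.min t (u / c))).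
by move=> /(_ measurableT [set true]); rewrite setTI; exact.
Qed.

Lemma measurable_above t : measurable [set w | t <= W w].
Proof. exact: measurable_set_ler. Qed.

(** On [below u t] the integrand is the conditional probability of
    [first_payment_split], a measurable function of (W, X) as the measure of a
    section of a measurable set. *)
Lemma measurable_fredholm_integrand u t : 0 < u -> 0 < t ->
  measurable_fun setT (fun w => (\1_(below u t) w *
     default_prob P c Ws Xs (expR (X w) * (u - c * W w)) (t - W w))%:E).
Proof.
move=> u0 t0; have [mg _] := iid_law_cons mZ mY ident indep (measurable_no_hit_before c u t).
rewrite (_ : (fun w => _) = (fun w => (\1_(below u t) w)%:E *
    P [set w' | D u t (path_cons (Z w, path w'))])%E).
  apply: emeasurable_funM => //.
  exact/measurable_EFinP/measurable_indic/measurable_below.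
apply/funext => w; rewrite indicE.
have [/set_mem wb|_] := boolP (w \in below u t); last by rewrite mul0r mul0e.
move: (wb); rewrite /below/= lt_min => /andP[Wt Wu].
rewrite first_payment_split//; last by left => Wuc; rewrite Wuc ltxx in Wu.
rewrite [X in (X * _)%:E]indicE memNset; last by apply/negP; rewrite -ltNge.
by rewrite indicE mem_set// mul0r add0e mul1e.
Qed.

Lemma integral_phi0 u t :
  (\int[P]_w (\1_[set w' | t <= W w'] w * (t <= u / c)%R%:R)%:E)%E =
  (default_prob0 P c W u t)%:E.
Proof.
rewrite /default_prob0 EFinM fineK; last exact/fin_num_measure/measurable_above.
under eq_integral do rewrite EFinM.
rewrite ge0_integralZr//; last exact/measurable_EFinP/measurable_indic/measurable_above.
by rewrite integral_indic ?setIT//; exact: measurable_above.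
Qed.

Lemma first_payment_equation u t : 0 < u -> 0 < t ->
  default_prob P c Ws Xs u t =
    default_prob0 P c W u t + fredholm_op P c W X (default_prob P c Ws Xs) u t.
Proof.
move=> u0 t0.
have [mg gE] := iid_law_cons mZ mY ident indep (measurable_no_hit_before c u t).
have mF2 := measurable_fredholm_integrand u0 t0.
pose F1 w := (\1_[set w' | t <= W w'] w * (t <= u / c)%R%:R)%:E : \bar R.
pose F2 w := (\1_(below u t) w *
     default_prob P c Ws Xs (expR (X w) * (u - c * W w)) (t - W w))%:E.
have mF1 : measurable_fun setT F1.
  apply/measurable_EFinP/measurable_funM => //.
  exact/measurable_indic/measurable_above.
have F1_ge0 w : (0 <= F1 w)%E by rewrite lee_fin mulr_ge0// ler0n.
have F2_ge0 w : (0 <= F2 w)%E by rewrite lee_fin mulr_ge0// fine_ge0.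
have sumE : (P (path @^-1` D u t) = \int[P]_w F1 w + \int[P]_w F2 w)%E.
  rewrite [LHS]gE -ge0_integralD//.
  apply: ae_eq_integral => //; first exact: emeasurable_funD.
  have [Wa|q0] := no_positive_atom_or_no_standstill (divr_gt0 u0 c_gt0); last first.
    by apply: aeW => w _; apply: first_payment_split => //; right.
  exists [set w | W w = u / c]; split; last 1 first.
  - move=> w /= H; apply: contrapT => Wn; apply: H => _.
    by apply: first_payment_split => //; left.
  - exact: (measurable_funPTI W (measurable_set1 _)).
  - exact: Wa.
have F2_fin : (\int[P]_w F2 w)%E \is a fin_num.
  have : P (path @^-1` D u t) \is a fin_num by exact: fin_num_measure.
  by rewrite sumE fin_numD => /andP[].
apply: EFin_inj; rewrite EFinD default_probE// sumE integral_phi0; congr (_ + _)%E.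
by rewrite /fredholm_op unlock fineK.
Qed.

End first_payment.

Theorem theorem2p1 (d : measure_display) (Omega : measurableType d)
    (R : realType) (P : probability Omega R) (c : R)
    (W X : {RV P >-> R}) (Ws Xs : nat -> {RV P >-> R})
    (c_gt0 : 0 < c)
    (W_ge0 : forall w, 0 <= W w) (X_gt0 : forall w, 0 < X w)
    (Ws_ge0 : forall i w, 0 <= Ws i w) (Xs_gt0 : forall i w, 0 < Xs i w)
    (ident : forall i, identically_distributed P
               (fun w => (Ws i w, Xs i w)) (fun w => (W w, X w)))
    (indep : mutually_independent P (fun i w => (Ws i w, Xs i w)))
    (u t : R) (u_gt0 : 0 < u) (t_gt0 : 0 < t) :
  default_prob P c Ws Xs u t =
    default_prob0 P c W u t + fredholm_op P c W X (default_prob P c Ws Xs) u t.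
Proof. exact: first_payment_equation. Qed.
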